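(* Let $p$ be a prime and $n,k$ positive integers with $k<n$. Any classical algorithm (deterministic, or randomized with bounded error) solving the generalized Simon's problem $\mathsf{GSP}(p,n,k)$ must make $\Omega\left(\max\{k,\sqrt{p^{n-k}}\}\right)$ queries to $f$ in the worst case.
   Context: $\mathbb{Z}_p^n$ is the additive group of $n$-tuples over $\mathbb{Z}_p$ with componentwise addition mod $p$; its subgroups are exactly the $\mathbb{F}_p$-linear subspaces, and the rank of a subgroup is the size of a minimal generating set (its dimension). The problem $\mathsf{GSP}(p,n,k)$: one is given oracle access to an unknown function $f:\mathbb{Z}_p^n\to X$, where $X$ is a finite set, with the promise that there is a subgroup $S\le\mathbb{Z}_p^n$ of rank $k$ such that for all $x,y\in\mathbb{Z}_p^n$, $f(x)=f(y)$ iff $x-y\in S$; the goal is to output $S$. A query returns $f(x)$ for a chosen $x$. A deterministic algorithm must always output $S$ correctly; a randomized algorithm must output $S$ with bounded error probability. The query complexity is the number of queries made in the worst case; the implied constants in $\Omega$ are absolute (independent of $p,n,k$). *)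

(* Defs.v *)
From HB Require Import structures.
From mathcomp Require Import all_boot all_order all_fingroup all_algebra all_solvable.
From mathcomp Require Import all_classical all_reals all_analysis.

Set Implicit Arguments.
Unset Strict Implicit.
Unset Printing Implicit Defensive.

Import Order.TTheory GRing.Theory Num.Theory.

Local Open Scope classical_set_scope.
Local Open Scope ring_scope.

(* Z_p^n as an additive group; 'F_p is Z_p for p prime, the only case used. *)
Notation Zpn p n := ('rV['F_p]_n).

(* 'm(S) is the size of a smallest generating set of S, for the finite group
   structure of Zpn p n, whose group law is addition. *)
Definition gsp_instance (p n k : nat) (X : finType)
    (f : {ffun Zpn p n -> X}) (S : {group Zpn p n}) : bool :=
  ('m(S)%g == k) && [forall x, forall y, (f x == f y) == (x - y \in S)].

Definition gsp_promise (p n k : nat) (X : finType)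
    (f : {ffun Zpn p n -> X}) : bool :=
  [exists S : {group Zpn p n}, gsp_instance k f S].

(* A deterministic classical query algorithm is a decision tree: it either
   stops with an output, or queries a point and continues according to the
   answer.  Outputs are arbitrary subsets of Z_p^n. *)
Inductive algorithm (p n : nat) (X : Type) : Type :=
  | Output of {set Zpn p n}
  | Query of Zpn p n & (X -> algorithm p n X).

Fixpoint run (p n : nat) (X : Type) (t : algorithm p n X)
    (f : Zpn p n -> X) : {set Zpn p n} :=
  match t with
  | Output out => out
  | Query x next => run (next (f x)) f
  end.

Fixpoint queries (p n : nat) (X : Type) (t : algorithm p n X)
    (f : Zpn p n -> X) : nat :=
  match t with
  | Output _ => 0
  | Query x next => (queries (next (f x)) f).+1
  end.

Definition solves_gsp (p n k : nat) (X : finType) (t : algorithm p n X) : Prop :=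
  forall (f : {ffun Zpn p n -> X}) (S : {group Zpn p n}),
    gsp_instance k f S -> run t f = S.

Definition worst_queries (p n k : nat) (X : finType) (t : algorithm p n X) : nat :=
  (\max_(f : {ffun Zpn p n -> X} | gsp_promise k f) queries t f)%N.

(* A randomized algorithm is a family of deterministic ones indexed by the
   outcomes w of a probability space (all coins are tossed in advance); the
   measurability requirement makes the success probability meaningful. *)
Definition randomized_solves_gsp (R : realType) (d : measure_display)
    (W : measurableType d) (P : probability W R) (p n k : nat) (X : finType)
    (A : W -> algorithm p n X) (eps : R) : Prop :=
  forall (f : {ffun Zpn p n -> X}) (S : {group Zpn p n}),
    gsp_instance k f S ->
    measurable [set w | run (A w) f = S] /\
    ((1 - eps)%:E <= P [set w | run (A w) f = S])%E.

(* Worst case over both the promised inputs and the coin outcomes; +oo if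
   the number of queries is unbounded. *)
Definition randomized_worst_queries (R : realType) (d : measure_display)
    (W : measurableType d) (p n k : nat) (X : finType)
    (A : W -> algorithm p n X) : \bar R :=
  ereal_sup [set (worst_queries k (A w))%:R%:E | w in [set: W]].
Arguments randomized_worst_queries R {d W p n} k {X} A.

(* Main.v *)
Require Import Defs.
From HB Require Import structures.
From mathcomp Require Import all_boot all_order all_fingroup all_algebra all_solvable.
From mathcomp Require Import all_classical all_reals all_analysis.
From mathcomp Require Import measurable_realfun zify lra.

Import Order.TTheory GRing.Theory Num.Theory.
Local Open Scope ring_scope.

(* Write n = k + r.  The hard instances hide the graph S_M = {(u, u M)} of a
   k x r matrix M, through f(u, v) = iota (s (v - u M)) with s a permutation of
   Z_p^r and iota an embedding of Z_p^r into X.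
   With s = 1 there are p^(k r) graphs, while Q queries with p^r possible answers
   reach at most p^(r Q) outputs, so success on a majority of them forces k <= Q.
   When s is uniformly random, answers carry no information on M as long as
   distinct queries get distinct answers, and two given points collide for at
   most a p^-r fraction of the matrices M; hence Q queries succeed with
   probability at most p^-(k r) + Q^2 p^-r, and a majority forces p^r <= 4 Q^2.
   For a randomized algorithm, averaging over the coins gives, for each of the two
   families, an outcome for which the deterministic algorithm succeeds on a
   majority of the family. *)

(** * Cardinality of unions and of permutations with prescribed values *)

Lemma card_bigcup_leq (T J : finType) (P : pred J) (F : J -> {set T}) :
  (#|\bigcup_(j | P j) F j| <= \sum_(j | P j) #|F j|)%N.
Proof.
elim/big_ind2: _ => [|a A b B hA hB|//]; first by rewrite cards0.
exact: leq_trans (leq_card_setU A B) (leq_add hA hB).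
Qed.

(** Fix one such permutation [s0]. For every other [s], the product [s * s0^-1] fixes each first
    component of [h], hence moves only points of [D], and [s] is recovered from it. *)
Lemma card_perm_prescribed (Y : finType) (h : seq (Y * Y)) :
  uniq (unzip1 h) ->
  (#|[set s : {perm Y} | all (fun e => s e.1 == e.2) h]| <= (#|Y| - size h)`!)%N.
Proof.
move=> uh; set C := [set s | _].
have [->|[s0 s0C]] := set_0Vmem C; first by rewrite cards0.
set D := ~: [set y in unzip1 h].
have cD : #|D| = (#|Y| - size h)%N.
  by rewrite cardsCs finset.setCK cardsE (card_uniqP uh) size_map.
rewrite -cD -(card_perm D) -(card_imset _ (mulIg s0^-1%g)).
apply/subset_leq_card/fintype.subsetP => _ /imsetP[s sC ->].
apply/fintype.subsetP => y; rewrite inE permM => nfix.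
rewrite !inE; apply: contra nfix => /mapP[e eh ->].
move: sC s0C; rewrite !inE => /allP/(_ e eh)/eqP-> /allP/(_ e eh)/eqP<-.
by rewrite permK.
Qed.

(** * Successes of a decision tree over an abstract family of instances *)

Section Counting.
Variables (p n : nat) (X I Y : finType).
Variables (iota : Y -> X) (q : I -> Zpn p n -> Y) (S : I -> {set Zpn p n}).
Hypothesis S_inj : injective S.

Lemma card_output_leq1 (A : {set I}) (out : {set Zpn p n}) :
  (#|[set i in A | out == S i]| <= 1)%N.
Proof.
apply/card_le1_eqP => i j; rewrite !inE => /andP[_ /eqP->] /andP[_ /eqP].
by move/S_inj.
Qed.

(** A query splits [A] into at most [#|Y|] classes by the value of [q i x], and a leaf is right for
    at most one index because [S] is injective. *)
Lemma card_leaves_leq (F : I -> Zpn p n -> X) (t : algorithm p n X) (Q : nat)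
    (A : {set I}) :
  (0 < #|Y|)%N -> (forall i v, F i v = iota (q i v)) ->
  (#|[set i in A | (run t (F i) == S i) && (queries t (F i) <= Q)%N]| <= #|Y| ^ Q)%N.
Proof.
move=> Y_gt0 FE; elim: t Q A => [out|x next IH] Q A /=.
  apply: (@leq_trans 1); last by rewrite expn_gt0 Y_gt0.
  apply: leq_trans (card_output_leq1 A out); apply/subset_leq_card/fintype.subsetP => i.
  by rewrite !inE => /and3P[-> ->].
case: Q => [|Q].
  by rewrite (_ : [set _ in _ | _] = finset.set0) ?cards0 //; apply/setP => i; rewrite !inE !andbF.
pose B y := [set i in [set i in A | q i x == y] |
   (run (next (iota y)) (F i) == S i) && (queries (next (iota y)) (F i) <= Q)%N].
apply: (@leq_trans #|\bigcup_y B y|).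
  apply/subset_leq_card/fintype.subsetP => i; rewrite inE ltnS FE => /andP[iA h].
  by apply/bigcupP; exists (q i x) => //; rewrite !inE iA eqxx.
apply: leq_trans (card_bigcup_leq _ _ _ _) _.
apply: (@leq_trans (\sum_(y : Y) #|Y| ^ Q)%N); first by apply: leq_sum => y _; apply: IH.
by rewrite sum_nat_const expnS.
Qed.

Variable B : nat.
Hypothesis collision_bound : forall x y, x != y -> (#|[set i | q i x == q i y]| <= B)%N.
Variable F : I -> {perm Y} -> Zpn p n -> X.
Hypothesis FE : forall i s v, F i s v = iota (s (q i v)).

Definition consistent (i : I) (s : {perm Y}) (h : seq (Zpn p n * Y)) :=
  all (fun e => s (q i e.1) == e.2) h.

Definition collision_free (h : seq (Zpn p n * Y)) (i : I) :=
  uniq [seq q i e.1 | e <- h].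

(* [h] lists the points queried so far, each with the argument of [iota] in its answer. *)
Definition wins (t : algorithm p n X) (Q : nat) (h : seq (Zpn p n * Y)) :=
  [set z : I * {perm Y} | [&& collision_free h z.1, consistent z.1 z.2 h,
     run t (F z.1 z.2) == S z.1 & (queries t (F z.1 z.2) <= Q)%N]].

Lemma card_consistent (h : seq (Zpn p n * Y)) (i : I) : collision_free h i ->
  (#|[set s | consistent i s h]| <= (#|Y| - size h)`!)%N.
Proof.
move=> cf; have := @card_perm_prescribed _ [seq (q i e.1, e.2) | e <- h].
rewrite size_map /unzip1 -map_comp => /(_ cf); apply: leq_trans.
apply/subset_leq_card/fintype.subsetP => s; rewrite !inE /consistent all_map.
by [].
Qed.

Lemma card_consistent_pairs (h : seq (Zpn p n * Y)) (A : {set I}) :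
  {in A, forall i, collision_free h i} ->
  (#|[set z : I * {perm Y} | (z.1 \in A) && consistent z.1 z.2 h]|
     <= #|A| * (#|Y| - size h)`!)%N.
Proof.
move=> cf.
apply: (@leq_trans #|\bigcup_(i in A) finset.setX [set i] [set s | consistent i s h]|).
  apply/subset_leq_card/fintype.subsetP => -[i s]; rewrite inE /= => /andP[iA cs].
  by apply/bigcupP; exists i => //; rewrite !inE eqxx.
apply: leq_trans (card_bigcup_leq _ _ _ _) _.
rewrite -sum_nat_const; apply: leq_sum => i iA.
by rewrite cardsX cards1 mul1n card_consistent // cf.
Qed.

(** Union bound over the points of [h], each of which differs from [x]. *)
Lemma card_new_collision (x : Zpn p n) (h : seq (Zpn p n * Y)) :
  x \notin unzip1 h ->
  (#|[set i | q i x \in [seq q i e.1 | e <- h]]| <= size h * B)%N.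
Proof.
elim: h => [_|[x' a] h IH /=].
  by rewrite (_ : [set i | _] = finset.set0) ?cards0 //; apply/setP => i; rewrite !inE.
rewrite inE negb_or => /andP[xx' /IH le_h].
rewrite mulSn; apply: leq_trans (leq_add (collision_bound _ _ xx') le_h).
apply: leq_trans (leq_card_setU _ _).
by apply/subset_leq_card/fintype.subsetP => i; rewrite !inE.
Qed.

(* [(#|Y| - size h)`!] bounds the number of permutations compatible with [h].  The
   term 1 accounts for the output being right for a single [i], the other one
   for the indices that a new query makes collide. *)
Lemma card_wins (t : algorithm p n X) (Q : nat) (h : seq (Zpn p n * Y)) :
  uniq (unzip2 h) ->
  (#|wins t Q h| <= (#|Y| - size h)`! * (1 + Q * (size h + Q) * B))%N.
Proof.
elim: t Q h => [out|x next IH] Q h uh.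
  set A := [set i in [set i | collision_free h i] | out == S i].
  have cA : {in A, forall i, collision_free h i} by move=> i; rewrite !inE => /andP[].
  apply: (@leq_trans (#|A| * (#|Y| - size h)`!)); last first.
    rewrite mulnC leq_mul2l; apply/orP; right.
    by apply: leq_trans (card_output_leq1 [set i | collision_free h i] out) _; rewrite leq_addr.
  apply: leq_trans (card_consistent_pairs _ _ cA).
  apply/subset_leq_card/fintype.subsetP => -[i s]; rewrite !inE /=.
  by case/and4P => -> -> ->.
case: Q => [|Q].
  rewrite (_ : wins _ _ _ = finset.set0) ?cards0 //.
  by apply/setP => z; rewrite !inE /= !andbF.
(* A repeated query gets the recorded answer and must leave [h] unchanged, since a repeated point
   would break [collision_free]. *)
have [/mapP[[x' a] ah /= ->]|xh] := boolP (x \in unzip1 h).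
  apply: (@leq_trans #|wins (next (iota a)) Q h|).
    apply/subset_leq_card/fintype.subsetP => -[i s]; rewrite !inE /= ltnS FE => /and4P[-> cs].
    by move/allP: (cs) => /(_ _ ah) /= /eqP ->; rewrite cs => -> ->.
  apply: leq_trans (IH _ _ _ uh) _.
  rewrite leq_mul2l leq_add2l leq_mul2r leq_mul ?orbT //; lia.
(* Indices for which [x] collides with an earlier point are conceded: [W] counts all their
   consistent pairs as wins. *)
pose A := [set i | collision_free h i & q i x \in [seq q i e.1 | e <- h]].
have cA : {in A, forall i, collision_free h i} by move=> i; rewrite inE => /andP[].
pose fresh := [pred a | a \notin unzip2 h].
set W := [set z : I * {perm Y} | (z.1 \in A) && consistent z.1 z.2 h].
(* Without a collision, injectivity of [s] forces an answer not yet in [h], so the history grows by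
   [(x, a)] with [a] fresh. *)
pose V := \bigcup_(a | fresh a) wins (next (iota a)) Q ((x, a) :: h).
have sub : wins (Query x next) Q.+1 h \subset W :|: V.
  apply/fintype.subsetP => -[i s]; rewrite !inE /= ltnS FE => /and4P[cf cs out le_Q].
  rewrite cf cs /= andbT; have [//|qx /=] := boolP (q i x \in _).
  apply/bigcupP; exists (s (q i x)).
    rewrite inE; apply: contra qx => /mapP[e eh /= e2].
    move/allP: (cs) => /(_ _ eh) /eqP; rewrite -e2 => /perm_inj <-.
    by apply/mapP; exists e.
  rewrite inE /= out le_Q !andbT; apply/andP; split; first by rewrite /collision_free /= qx.
  by rewrite /consistent /= eqxx.
apply: leq_trans (subset_leq_card sub) (leq_trans (leq_card_setU _ _) _).
set m := size h; set N := #|Y|.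
have leW : (#|W| <= m * B * (N - m)`!)%N.
  apply: leq_trans (card_consistent_pairs _ _ cA) _; rewrite leq_mul2r; apply/orP; right.
  apply: leq_trans (card_new_collision _ _ xh).
  by apply/subset_leq_card/fintype.subsetP => i; rewrite !inE => /andP[].
have leV : (#|V| <= (N - m)`! * (1 + Q * (m.+1 + Q) * B))%N.
  apply: leq_trans (card_bigcup_leq _ _ _ _) _.
  apply: (@leq_trans (\sum_(a | fresh a) (N - m.+1)`! * (1 + Q * (m.+1 + Q) * B))%N).
    by apply: leq_sum => a fa; apply: IH; rewrite /= uh andbT.
  rewrite sum_nat_const mulnA leq_mul2r; apply/orP; right.
  have -> : #|fresh| = (N - m)%N.
    have := cardC (mem (unzip2 h)); rewrite (card_uniqP uh) size_map -/N -/m => <-.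
    by rewrite addKn; apply: eq_card => a; rewrite !inE.
  (* If no fresh answer is left, the factor [N - m] is zero; otherwise this is the recursion of the
     factorial. *)
  by case: (N - m)%N (subnS N m) => [|d] ->.
apply: leq_trans (leq_add leW leV) _.
rewrite mulnC -mulnDr leq_mul2l; apply/orP; right.
rewrite addnCA leq_add2l -mulnDl leq_mul2r; apply/orP; right; nia.
Qed.
End Counting.

(** * Averaging over the coins *)

(** The expected number of events [E j] that occur is at least [#|J| * (1 - eps)], which exceeds
    [#|J| / 2]; so it cannot be at most [#|J| / 2] at every outcome. *)
Lemma ex_majority_outcome (R : realType) (d : measure_display)
    (W : measurableType d) (P : probability W R) (J : finType) (E : J -> set W)
    (eps : R) :
  (0 < #|J|)%N -> eps < 2^-1 ->
  (forall j, measurable (E j) /\ ((1 - eps)%:E <= P (E j))%E) ->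
  exists w, (#|J| < 2 * #|[set j | `[< E j w >]]|)%N.
Proof.
move=> J_gt0 eps_lt hE; apply: contrapT => /forallNP few.
have mE j : measurable (E j) := (hE j).1.
have mI j : measurable_fun setT (EFin \o (\1_(E j) : W -> R)).
  by apply/measurable_EFinP; exact: measurable_indic.
pose g (w : W) : \bar R := (\sum_(j : J) (\1_(E j) w)%:E)%E.
have sumP : (\int[P]_w g w = \sum_(j : J) P (E j))%E.
  rewrite ge0_integral_sum //; apply: eq_bigr => j _.
  by rewrite integral_indic // setIT.
have upper : (\int[P]_w g w <= (#|J|%:R / 2)%:E)%E.
  rewrite -[leRHS]mule1 -(probability_setT P) -integral_cst //.
  apply: ge0_le_integral => //.
  - by move=> w _; apply: sume_ge0 => j _; rewrite lee_fin.
  - exact: emeasurable_sum.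
  move=> w _; rewrite /g sumEFin lee_fin ler_pdivlMr //.
  have -> : \sum_(j : J) \1_(E j) w = #|[set j | `[< E j w >]]|%:R :> R.
    rewrite -sum1_card natr_sum [RHS]big_mkcond; apply: eq_bigr => j _.
    rewrite finset.inE indicE.
    by case: asboolP => h; [rewrite mem_set|rewrite memNset].
  by rewrite -natrM ler_nat mulnC leqNgt; apply/negP/few.
have lower : ((#|J|%:R * (1 - eps))%:E <= \sum_(j : J) P (E j))%E.
  rewrite mulr_natl -sumr_const -sumEFin.
  by apply: lee_sum => j _; exact: (hE j).2.
rewrite sumP in upper; move: (le_trans lower upper).
rewrite lee_fin ler_pM2l ?ltr0n //; lra.
Qed.

(** * Graphs of matrices as subgroups of rank [k] *)

Section GraphFamily.
Variables (p k r : nat).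
Hypothesis p_prime : prime p.

Definition graph_set (M : 'M['F_p]_(k, r)) : {set Zpn p (k + r)} :=
  [set v : Zpn p (k + r) | rsubmx v == lsubmx v *m M].

(** The linear map with kernel [graph_set M]: its values name the cosets, by the same set of labels
    for all [M]. *)
Definition graph_quotient (M : 'M['F_p]_(k, r)) (v : Zpn p (k + r)) : 'rV['F_p]_r :=
  rsubmx v - lsubmx v *m M.

Lemma graph_quotientB (M : 'M['F_p]_(k, r)) (v w : Zpn p (k + r)) :
  graph_quotient M v - graph_quotient M w = graph_quotient M (v - w).
Proof. by rewrite /graph_quotient !linearB /= mulmxBl !opprD !opprK addrACA. Qed.

Lemma in_graph_set M v : (v \in graph_set M) = (graph_quotient M v == 0).
Proof. by rewrite inE subr_eq0. Qed.

Lemma graph_group_set (M : 'M['F_p]_(k, r)) : group_set (graph_set M).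
Proof.
apply/group_setP; split; first by rewrite inE FinRing.zmod1gE !linear0 mul0mx.
move=> v w; rewrite !inE FinRing.zmodMgE !linearD /= mulmxDl => /eqP-> /eqP->.
exact: eqxx.
Qed.

Canonical graph_group (M : 'M['F_p]_(k, r)) := Group (graph_group_set M).

Lemma graph_set_inj : injective graph_set.
Proof.
move=> M M' eqS; apply/row_matrixP => i.
have : row_mx (delta_mx 0 i) (row i M) \in graph_set M.
  by rewrite inE row_mxKr row_mxKl -rowE.
by rewrite eqS inE row_mxKr row_mxKl -rowE => /eqP.
Qed.

Lemma card_graph_set (M : 'M['F_p]_(k, r)) : #|graph_set M| = (p ^ k)%N.
Proof.
have -> : graph_set M = [set row_mx u (u *m M) | u in [set: 'rV['F_p]_k]].
  apply/setP => v; rewrite inE; apply/eqP/imsetP => [vM|[u _ ->]].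
    by exists (lsubmx v); rewrite ?inE // -vM hsubmxK.
  by rewrite row_mxKr row_mxKl.
rewrite card_imset ?cardsT ?card_mx ?mul1n ?card_Fp //.
by move=> u u' /eq_row_mx[].
Qed.

(** The graph is elementary abelian of order [p ^ k], so its rank is the exponent of [p] in its
    order. *)
Lemma grank_graph_set (M : 'M['F_p]_(k, r)) : 'm(graph_set M)%g = k.
Proof.
rewrite (grank_abelian (FinRing.zmod_abelian _)).
have ab : p.-abelem%g (graph_set M).
  apply/abelemP => //; split; first exact: FinRing.zmod_abelian.
  move=> v _; rewrite FinRing.zmodXgE FinRing.zmod1gE -scaler_nat.
  by rewrite pchar_Fp_0 // scale0r.
by rewrite (rank_abelem ab) card_graph_set pfactorK.
Qed.

(** A collision puts [d = v - w] on the graph. If the left part of [d] is zero, so is the right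
    part, which is impossible; if its coordinate [i] is nonzero, row [i] of [M] is determined by the
    other rows. *)
Lemma card_graph_collision (v w : Zpn p (k + r)) : v != w ->
  (#|[set M | graph_quotient M v == graph_quotient M w]| <= p ^ (k.-1 * r))%N.
Proof.
rewrite -subr_eq0 => d_neq0.
set d := v - w in d_neq0.
have E M : (graph_quotient M v == graph_quotient M w) = (d \in graph_set M).
  by rewrite in_graph_set -graph_quotientB subr_eq0.
have [l0|/rV0Pn[i ui]] := eqVneq (lsubmx d) 0.
  rewrite (_ : [set M | _] = finset.set0) ?cards0 //; apply/setP => M.
  rewrite !inE E inE l0 mul0mx; apply/negP => /eqP r0.
  by case/eqP: d_neq0; rewrite -[d]hsubmxK l0 r0 row_mx0.
have <- : #|{: 'M['F_p]_(k.-1, r)}| = (p ^ (k.-1 * r))%N by rewrite card_mx card_Fp.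
rewrite -(@card_in_imset _ _ (row' i)) ?max_card // => M M'.
rewrite !inE !E !inE => /eqP dM /eqP dM' eqM.
have : lsubmx d *m (M - M') = 0 by rewrite mulmxBr -dM -dM' subrr.
have rowD j : j != i -> row j M = row j M'.
  case: (unliftP i j) => [j' ->|->]; last by rewrite eqxx.
  by move=> _; move/(congr1 (row j')): eqM; rewrite !row_rowsub.
have rowB j : row j (M - M') = row j M - row j M' by exact: linearB.
move=> D0; apply/row_matrixP => j.
have [->|/rowD//] := eqVneq j i.
move: D0; rewrite mulmx_sum_row (bigD1 i) //= big1 ?addr0.
  by move/eqP; rewrite scaler_eq0 (negPf ui) rowB subr_eq0 => /eqP.
by move=> j' /rowD e; rewrite rowB e subrr scaler0.
Qed.

End GraphFamily.

(** * Query bounds for functions hiding a graph *)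

Lemma ex_injection (T U : finType) : (#|T| <= #|U|)%N -> exists f : T -> U, injective f.
Proof.
move=> le_TU; exists (fun x => enum_val (widen_ord le_TU (enum_rank x))) => x y.
move=> eq_xy; apply: enum_rank_inj; apply: ord_inj.
exact: (congr1 val (enum_val_inj eq_xy)).
Qed.

Section HiddenGraph.
Variables (p k r : nat) (X : finType) (iota : 'rV['F_p]_r -> X).
Hypotheses (p_prime : prime p) (iota_inj : injective iota).

Definition hidden (M : 'M['F_p]_(k, r)) (s : {perm 'rV['F_p]_r}) :
    {ffun Zpn p (k + r) -> X} :=
  [ffun v => iota (s (graph_quotient p k r M v))].

Lemma hidden_instance M s : gsp_instance k (hidden M s) (graph_group p k r M).
Proof.
rewrite /gsp_instance /= grank_graph_set // eqxx /=.
apply/forallP => v; apply/forallP => w; rewrite !ffunE.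
by rewrite (inj_eq iota_inj) (inj_eq perm_inj) in_graph_set -graph_quotientB subr_eq0.
Qed.

Lemma queries_hidden (t : algorithm p (k + r) X) M s :
  (queries t (hidden M s) <= worst_queries k t)%N.
Proof.
have promised : gsp_promise k (hidden M s).
  by apply/existsP; exists (graph_group p k r M); exact: hidden_instance.
by rewrite /worst_queries (bigD1 (hidden M s)) //= leq_maxl.
Qed.

Lemma majority_rank_bound (t : algorithm p (k + r) X) : (0 < r)%N ->
  (#|{: 'M['F_p]_(k, r)}| < 2 * #|[set M | run t (hidden M 1%g) == graph_set p k r M]|)%N ->
  (k <= worst_queries k t)%N.
Proof.
move=> r_gt0; set Q := worst_queries k t; set G := [set M | _] => maj.
have Y_gt0 : (0 < #|{: 'rV['F_p]_r}|)%N by apply/card_gt0P; exists 0.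
have le_G : (#|G| <= p ^ (r * Q))%N.
  have -> : (p ^ (r * Q) = #|{: 'rV['F_p]_r}| ^ Q)%N.
    by rewrite card_mx card_Fp // mul1n expnM.
  apply: leq_trans (card_leaves_leq _ _ _ _ _ _ _ _ (graph_set_inj p k r)
    (fun M => hidden M 1%g) t Q [set: _] Y_gt0 _).
    apply/subset_leq_card/fintype.subsetP => M; rewrite !inE => ->.
    exact: queries_hidden.
  by move=> M v; rewrite ffunE perm1.
rewrite card_mx card_Fp // in maj.
rewrite leqNgt; apply/negP => Qk.
(* If [Q < k], then [r * Q + 1 <= k * r] as [r] is positive, whereas the majority gives
   [p ^ (k * r) < 2 * p ^ (r * Q)]. *)
have : (p * p ^ (r * Q) <= p ^ (k * r))%N.
  by rewrite -expnS leq_pexp2l ?prime_gt0 //; nia.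
have := prime_gt1 p_prime; nia.
Qed.

Lemma majority_birthday_bound (t : algorithm p (k + r) X) : (0 < k)%N -> (0 < r)%N ->
  (#|{: 'M['F_p]_(k, r) * {perm 'rV['F_p]_r}}| <
     2 * #|[set z : 'M['F_p]_(k, r) * {perm 'rV['F_p]_r} |
              run t (hidden z.1 z.2) == graph_set p k r z.1]|)%N ->
  (p ^ r <= 4 * worst_queries k t ^ 2)%N.
Proof.
move=> k_gt0 r_gt0; set Q := worst_queries k t; set G := [set z | _] => maj.
have cY : #|{: 'rV['F_p]_r}| = (p ^ r)%N by rewrite card_mx card_Fp // mul1n.
set N := (p ^ r)%N in cY *; set B := (p ^ (k.-1 * r))%N.
have hiddenE M s v : hidden M s v = iota (s (graph_quotient p k r M v)) by rewrite ffunE.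
have le_G : (#|G| <= N`! * (1 + Q * Q * B))%N.
  have := @card_wins p (k + r) X _ _ iota _ _ (graph_set_inj p k r)
    _ (card_graph_collision p k r p_prime) _ hiddenE t Q [::] erefl.
  rewrite cY /= subn0 add0n; apply: leq_trans.
  apply/subset_leq_card/fintype.subsetP => z; rewrite !inE => ->.
  exact: queries_hidden.
have cP : #|{: {perm 'rV['F_p]_r}}| = N`!.
  by rewrite -cY -[in RHS]cardsT -card_perm; apply: eq_card => s; rewrite inE; apply/esym/fintype.subsetP => y; rewrite inE.
have cM : #|{: 'M['F_p]_(k, r)}| = (N * B)%N.
  by rewrite card_mx card_Fp // -expnD -mulSn prednK.
have B_gt0 : (0 < B)%N by rewrite expn_gt0 prime_gt0.
have N_gt1 : (1 < N)%N by rewrite -(exp1n r) ltn_exp2r // prime_gt1.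
rewrite card_prod cP cM in maj.
have : (N * B < 2 * (1 + Q * Q * B))%N.
  rewrite -(ltn_pmul2r (fact_gt0 N)); apply: leq_trans maj _.
  by rewrite -mulnA [((1 + _) * _)%N]mulnC leq_mul2l le_G.
(* For [Q = 0] this reads [N * B < 2], which is false. For [Q > 0] the summand 1 is at most
   [Q * Q * B], whence the factor 4. *)
move: B_gt0 N_gt1; clear; case: Q => [|Q] B_gt0 N_gt1; first nia.
rewrite -mulnn; nia.
Qed.
End HiddenGraph.

(* If #|X| < p ^ (n - k) then no function satisfies the promise. *)
Theorem theorem1 (R : realType) :
  exists c : R, 0 < c /\
    forall (p n k : nat) (X : finType),
      prime p -> (0 < k)%N -> (k < n)%N -> (p ^ (n - k) <= #|X|)%N ->
      (forall t : algorithm p n X,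
         solves_gsp k t ->
         c * Num.max k%:R (Num.sqrt (p ^ (n - k))%:R) <= (worst_queries k t)%:R)
      /\
      (forall (d : measure_display) (W : measurableType d)
              (P : probability W R) (A : W -> algorithm p n X) (eps : R),
         0 <= eps -> eps < 2^-1 ->
         randomized_solves_gsp P k A eps ->
         ((c * Num.max k%:R (Num.sqrt (p ^ (n - k))%:R))%:E
            <= randomized_worst_queries R k A)%E).
Proof.
(* The birthday bound [p ^ r <= 4 * Q ^ 2] gives [sqrt (p ^ r) <= 2 * Q], hence one half; the bound
   [k <= Q] would allow 1. *)
exists (2^-1); split; first by rewrite invr_gt0.
move=> p n k X p_prime k_gt0 ltkn.
have [r -> {n ltkn} r_gt0] : exists2 r, n = (k + r)%N & (0 < r)%N.
  by exists (n - k)%N; [rewrite subnKC // ltnW|rewrite subn_gt0].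
rewrite addKn => le_X.
have [iota iota_inj] : exists f : 'rV['F_p]_r -> X, injective f.
  by apply: ex_injection; rewrite card_mx card_Fp // mul1n.
have max_half (a b x : R) : a <= x -> b <= 2 * x -> 0 <= a -> 2^-1 * Num.max a b <= x.
  by move=> ax bx a0; rewrite maxEle; case: ifP => _; lra.
have sqrt_bound Q : (p ^ r <= 4 * Q ^ 2)%N -> Num.sqrt (p ^ r)%:R <= 2 * Q%:R :> R.
  move=> le_Q; rewrite -(ger0_norm (_ : 0 <= 2 * Q%:R)) ?mulr_ge0 // -sqrtr_sqr.
  by rewrite ler_wsqrtr // exprMn -natrX -natrX -natrM ler_nat.
split=> [t solves|d W P A eps eps_ge0 eps_lt solves].
  (* A deterministic solver is right on the whole of each family, a majority because the families
     are nonempty. *)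
  have runE M s : run t (hidden p k r X iota M s) = graph_set p k r M.
    by apply: (solves _ (graph_group p k r M)); exact: hidden_instance.
  apply: max_half => //.
    rewrite ler_nat; apply: (@majority_rank_bound p k r X iota) => //.
    rewrite (_ : [set M | _] = finset.setT); last first.
      by apply/setP => M; rewrite !inE runE eqxx.
    by rewrite cardsT mul2n -addnn -[ltnLHS]addn0 ltn_add2l card_mx expn_gt0 card_Fp // prime_gt0.
  apply/sqrt_bound/(@majority_birthday_bound p k r X iota) => //.
  rewrite (_ : [set z | _] = finset.setT); last first.
    by apply/setP => z; rewrite !inE runE eqxx.
  rewrite cardsT mul2n -addnn -[ltnLHS]addn0 ltn_add2l.
  by apply/card_gt0P; exists (0, 1%g).
(* The index type [J] is left free to serve both families: matrices with the identity permutation,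
   and pairs of a matrix and a permutation. *)
have outcome (J : finType) (M : J -> 'M['F_p]_(k, r)) (s : J -> {perm 'rV['F_p]_r}) : (0 < #|J|)%N ->
    exists w, (#|J| < 2 * #|[set j | run (A w) (hidden p k r X iota (M j) (s j))
                                      == graph_set p k r (M j)]|)%N.
  move=> J_gt0.
  have [j|w maj] := @ex_majority_outcome R d W P J (fun j w =>
    run (A w) (hidden p k r X iota (M j) (s j)) = graph_set p k r (M j))
    eps J_gt0 eps_lt.
    by apply: (solves _ (graph_group p k r (M j))); exact: hidden_instance.
  exists w; rewrite (leq_trans maj) // leq_mul2l /= eq_leq //; apply: eq_card => j; rewrite !inE.
  by apply/asboolP/eqP.
have worst_le w : ((worst_queries k (A w))%:R%:E <= randomized_worst_queries R k A)%E.
  by apply: ereal_sup_ubound; exists w.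
have M_gt0 : (0 < #|{: 'M['F_p]_(k, r)}|)%N by apply/card_gt0P; exists 0.
have Ms_gt0 : (0 < #|{: 'M['F_p]_(k, r) * {perm 'rV['F_p]_r}}|)%N.
  by apply/card_gt0P; exists (0, 1%g).
have [w1 maj1] := outcome _ id (fun=> 1%g) M_gt0.
have [w2 maj2] := outcome _ fst snd Ms_gt0.
have le1 := majority_rank_bound p k r X iota p_prime iota_inj (A w1) r_gt0 maj1.
have le2 := majority_birthday_bound p k r X iota p_prime iota_inj (A w2) k_gt0 r_gt0 maj2.
(* The two families may select different outcomes; the one with the larger worst case satisfies both
   bounds. *)
have [le12|lt21] := leqP (worst_queries k (A w1)) (worst_queries k (A w2)).
  apply: le_trans (worst_le w2); rewrite lee_fin; apply: max_half => //.
    by rewrite ler_nat (leq_trans le1).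
  exact: sqrt_bound.
apply: le_trans (worst_le w1); rewrite lee_fin; apply: max_half => //.
  by rewrite ler_nat.
by apply: sqrt_bound; rewrite (leq_trans le2) // leq_mul2l leq_exp2r // ltnW.
Qed.
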